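(* Let $\mathcal{A}$ be a category with bifunctors $\oplus,\otimes$, an object $1$, and natural isomorphisms $l_X:1\otimes X\to X$, $r_X:X\otimes1\to X$, $c_{A,B}:A\otimes B\to B\otimes A$, $\mathfrak{L}_{A,X,Y}:A\otimes(X\oplus Y)\to(A\otimes X)\oplus(A\otimes Y)$, $\mathfrak{R}_{X,Y,A}:(X\oplus Y)\otimes A\to(X\otimes A)\oplus(Y\otimes A)$ (as in the data of a braided Ann-category). Suppose that for all objects $A,X,Y$: (5.1) $(l_X\oplus l_Y)\circ\mathfrak{L}_{1,X,Y}=l_{X\oplus Y}$; (6) $\mathfrak{R}_{X,Y,A}\circ c_{A,X\oplus Y}=(c_{A,X}\oplus c_{A,Y})\circ\mathfrak{L}_{A,X,Y}$; and that $c$ is compatible with the unit constraint $(1,l,r)$. Then for all objects $X,Y$: (5.2) $(r_X\oplus r_Y)\circ\mathfrak{R}_{X,Y,1}=r_{X\oplus Y}$.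
   Context: Compatibility of $c$ with the unit constraint $(1,l,r)$ means $r_X\circ c_{1,X}=l_X$ and $l_X\circ c_{X,1}=r_X$ for every object $X$. *)

(* Defs.v *)
From mathcomp Require Import all_boot.

Set Implicit Arguments.
Unset Strict Implicit.
Unset Printing Implicit Defensive.

Record category := Category {
  ob :> Type;
  hom : ob -> ob -> Type;
  idm : forall X : ob, hom X X;
  mcomp : forall X Y Z : ob, hom Y Z -> hom X Y -> hom X Z;
  mcomp1m : forall (X Y : ob) (f : hom X Y), mcomp (idm Y) f = f;
  mcompm1 : forall (X Y : ob) (f : hom X Y), mcomp f (idm X) = f;
  mcompA : forall (W X Y Z : ob) (h : hom Y Z) (g : hom X Y) (f : hom W X),
    mcomp h (mcomp g f) = mcomp (mcomp h g) f }.

Arguments hom {c}.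
Arguments idm {c}.
Arguments mcomp {c X Y Z}.

Declare Scope cat_scope.
Delimit Scope cat_scope with cat.
Notation "g \oc f" := (mcomp g f) (at level 50, left associativity) : cat_scope.
Local Open Scope cat_scope.

#[local] Obligation Tactic := intros => //=.

Definition is_iso (C : category) (X Y : C) (f : hom X Y) : Prop :=
  exists g : hom Y X, g \oc f = idm X /\ f \oc g = idm Y.

Record functor (C D : category) := Functor {
  fobj :> C -> D;
  fmap : forall X Y : C, hom X Y -> hom (fobj X) (fobj Y);
  fmap1 : forall X : C, fmap (idm X) = idm (fobj X);
  fmap_comp : forall (X Y Z : C) (g : hom Y Z) (f : hom X Y),
    fmap (g \oc f) = fmap g \oc fmap f }.

Arguments fmap {C D} _ {X Y}.

Record nat_iso (C D : category) (F G : functor C D) := NatIso {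
  component :> forall X : C, hom (F X) (G X);
  component_natural : forall (X Y : C) (f : hom X Y),
    component Y \oc fmap F f = fmap G f \oc component X;
  component_iso : forall X : C, is_iso (component X) }.

Program Definition prod_cat (C D : category) : category :=
  @Category (C * D)%type
    (fun X Y => (hom X.1 Y.1 * hom X.2 Y.2)%type)
    (fun X => (idm X.1, idm X.2))
    (fun _ _ _ g f => (g.1 \oc f.1, g.2 \oc f.2)) _ _ _.
Next Obligation. by rewrite !mcomp1m -surjective_pairing. Qed.
Next Obligation. by rewrite !mcompm1 -surjective_pairing. Qed.
Next Obligation. by rewrite !mcompA. Qed.

Definition bifunctor (C : category) := functor (prod_cat C C) C.

Definition fmap2 (C : category) (F : bifunctor C) (X X' Y Y' : C)
    (f : hom X X') (g : hom Y Y') : hom (F (X, Y)) (F (X', Y')) :=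
  @fmap _ _ F (X, Y) (X', Y') (f, g).

Program Definition id_functor (C : category) : functor C C :=
  @Functor C C (fun X => X) (fun _ _ f => f) _ _.

Program Definition const_functor (C D : category) (d : D) : functor C D :=
  @Functor C D (fun=> d) (fun _ _ _ => idm d) _ _.
Next Obligation. by rewrite mcomp1m. Qed.

Program Definition fst_functor (C D : category) : functor (prod_cat C D) C :=
  @Functor (prod_cat C D) C (fun X => X.1) (fun _ _ f => f.1) _ _.

Program Definition snd_functor (C D : category) : functor (prod_cat C D) D :=
  @Functor (prod_cat C D) D (fun X => X.2) (fun _ _ f => f.2) _ _.

Program Definition comp_functor (C D E : category)
    (G : functor D E) (F : functor C D) : functor C E :=
  @Functor C E (fun X => G (F X)) (fun _ _ f => fmap G (fmap F f)) _ _.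
Next Obligation. by rewrite !fmap1. Qed.
Next Obligation. by rewrite !fmap_comp. Qed.

(* [lift2 B F G] is the functor X |-> B (F X, G X). *)
Program Definition lift2 (C D : category) (B : bifunctor D)
    (F G : functor C D) : functor C D :=
  @Functor C D (fun X => B (F X, G X))
    (fun _ _ f => fmap2 B (fmap F f) (fmap G f)) _ _.
Next Obligation. by rewrite /fmap2 !fmap1 -(fmap1 B). Qed.
Next Obligation. by rewrite /fmap2 !fmap_comp -(fmap_comp B). Qed.

(* Coordinates on the cube of [C], whose objects are the triples (X, Y, Z). *)
Definition cube_cat (C : category) : category := prod_cat (prod_cat C C) C.

Definition pi1 (C : category) : functor (cube_cat C) C :=
  comp_functor (fst_functor C C) (fst_functor (prod_cat C C) C).
Definition pi2 (C : category) : functor (cube_cat C) C :=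
  comp_functor (snd_functor C C) (fst_functor (prod_cat C C) C).
Definition pi3 (C : category) : functor (cube_cat C) C :=
  snd_functor (prod_cat C C) C.

Definition left_unit_constraint (C : category) (otimes : bifunctor C) (one : C) :=
  nat_iso (lift2 otimes (const_functor C one) (id_functor C)) (id_functor C).

Definition right_unit_constraint (C : category) (otimes : bifunctor C) (one : C) :=
  nat_iso (lift2 otimes (id_functor C) (const_functor C one)) (id_functor C).

Definition commutativity_constraint (C : category) (otimes : bifunctor C) :=
  nat_iso otimes (lift2 otimes (snd_functor C C) (fst_functor C C)).

(* A (x) (X (+) Y) -> (A (x) X) (+) (A (x) Y), natural in (A, X, Y) *)
Definition left_distributivity_constraint (C : category)
    (oplus otimes : bifunctor C) :=
  nat_iso (lift2 otimes (pi1 C) (lift2 oplus (pi2 C) (pi3 C)))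
          (lift2 oplus (lift2 otimes (pi1 C) (pi2 C))
                       (lift2 otimes (pi1 C) (pi3 C))).

(* (X (+) Y) (x) A -> (X (x) A) (+) (Y (x) A), natural in (X, Y, A) *)
Definition right_distributivity_constraint (C : category)
    (oplus otimes : bifunctor C) :=
  nat_iso (lift2 otimes (lift2 oplus (pi1 C) (pi2 C)) (pi3 C))
          (lift2 oplus (lift2 otimes (pi1 C) (pi3 C))
                       (lift2 otimes (pi2 C) (pi3 C))).

Definition unit_compatible (C : category) (otimes : bifunctor C) (one : C)
    (l : left_unit_constraint otimes one) (r : right_unit_constraint otimes one)
    (c : commutativity_constraint otimes) : Prop :=
  forall X : C, r X \oc c (one, X) = l X /\ l X \oc c (X, one) = r X.

(* Main.v *)
Require Import Defs.
From mathcomp Require Import all_boot.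

Local Open Scope cat_scope.

(** The braiding transports the left-hand unit identity to the right-hand one. Since
    [c (one, oplus (X, Y))] is invertible, hence epi ([iso_epi]), it suffices to compare both sides
    after precomposing with it. By [R_braiding], [c_unit] and bifunctoriality of [oplus]
    ([fmap2_comp]), both become [fmap2 oplus (l X) (l Y) \oc L (one, X, Y)]. *)

Lemma iso_epi {C : category} {X Y Z : C} {f : hom X Y} {g h : hom Y Z} :
  is_iso f -> g \oc f = h \oc f -> g = h.
Proof.
by case=> k [_ fk] gfhf; rewrite -[g]mcompm1 -[h]mcompm1 -fk !mcompA gfhf.
Qed.

Lemma fmap2_comp {C : category} (F : bifunctor C) {X X' X'' Y Y' Y'' : C}
    (f' : hom X' X'') (f : hom X X') (g' : hom Y' Y'') (g : hom Y Y') :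
  fmap2 F f' g' \oc fmap2 F f g = fmap2 F (f' \oc f) (g' \oc g).
Proof. by rewrite /fmap2 -fmap_comp. Qed.

Theorem proposition3p4 (C : category) (oplus otimes : bifunctor C) (one : C)
    (l : left_unit_constraint otimes one)
    (r : right_unit_constraint otimes one)
    (c : commutativity_constraint otimes)
    (L : left_distributivity_constraint oplus otimes)
    (R : right_distributivity_constraint oplus otimes)
    (L_unit : forall X Y : C,
      fmap2 oplus (l X) (l Y) \oc L (one, X, Y) = l (oplus (X, Y)))
    (R_braiding : forall A X Y : C,
      R (X, Y, A) \oc c (A, oplus (X, Y)) =
      fmap2 oplus (c (A, X)) (c (A, Y)) \oc L (A, X, Y))
    (c_unit : unit_compatible l r c) :
  forall X Y : C,
    fmap2 oplus (r X) (r Y) \oc R (X, Y, one) = r (oplus (X, Y)).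
Proof.
move=> X Y.
refine (iso_epi (component_iso c (one, oplus (X, Y))) _).
rewrite (proj1 (c_unit (oplus (X, Y)))) -L_unit.
(* The intermediate objects of these composites agree only up to conversion, through [lift2] and the
   projections, so the chain is given by explicit terms. *)
refine (etrans (esym (mcompA (fmap2 oplus (r X) (r Y)) (R (X, Y, one)) (c (one, oplus (X, Y))))) _).
refine (etrans (congr1 (mcomp _) (R_braiding one X Y)) _).
refine (etrans (mcompA (fmap2 oplus (r X) (r Y))
  (fmap2 oplus (c (one, X)) (c (one, Y))) (L (one, X, Y))) _).
(* With [L] stripped from both sides, [r \oc c = l] remains to be checked in each summand. *)
apply: (congr1 (fun u => u \oc L (one, X, Y))).
refine (etrans (fmap2_comp oplus (r X) (c (one, X)) (r Y) (c (one, Y))) _).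
exact: f_equal2 (proj1 (c_unit X)) (proj1 (c_unit Y)).
Qed.
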